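(* For every integer $m\ge1$, the $m$-dimensional Gromov-mass-star volume $\mu^{{\rm m}*}$ is Euclidean rigid. That is, if $\|\cdot\|$ is a norm on $\mathbf R^m$ with $\|\cdot\|\ge|\cdot|$ and $\mu^{{\rm m}*}_{\|\cdot\|}\le\mu^{{\rm m}*}_{|\cdot|}$, then $\|\cdot\|=|\cdot|$.
   Context: $|\cdot|$ is the standard Euclidean norm on $\mathbf R^m$. An $m$-dimensional Finsler volume $\mu$ assigns to every $m$-dimensional normed space $V$ a Haar measure $\mu_V$ such that: (1) if $A:V\to W$ is linear with $\|A\|\le1$ then $\mu_W(A(B))\le\mu_V(B)$ for all Borel $B\subset V$; (2) if the norm of $V$ is induced by an inner product, $\mu_V$ is the standard Euclidean volume. For a norm $\|\cdot\|$ on $\mathbf R^m$ write $\mu_{\|\cdot\|}=\mu_{(\mathbf R^m,\|\cdot\|)}$. A Finsler volume $\mu$ is Euclidean rigid if every norm $\|\cdot\|$ on $\mathbf R^m$ with $\|\cdot\|\ge|\cdot|$ and $\mu_{\|\cdot\|}\le\mu_{|\cdot|}$ satisfies $\|\cdot\|=|\cdot|$. The Gromov-mass-star volume $\mu^{{\rm m}*}$ is the Finsler volume for which $\mu^{{\rm m}*}_V$ is the Haar measure on $V$ with $\mu^{{\rm m}*}_V(P)=2^m$ whenever $P$ is a parallelepiped of minimal volume among the parallelepipeds containing the closed unit ball $\mathbf B_V(0,1)$. *)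

(* Defs.v *)
From HB Require Import structures.
From mathcomp Require Import all_boot all_order all_algebra.
From mathcomp Require Import sesquilinear.
From mathcomp Require Import all_classical all_reals all_analysis.
From mathcomp Require Import ring lra.

Set Implicit Arguments.
Unset Strict Implicit.
Unset Printing Implicit Defensive.

Import Order.TTheory GRing.Theory Num.Theory.
Import numFieldNormedType.Exports.

Local Open Scope classical_set_scope.
Local Open Scope ring_scope.

#[short(type="normedVectType")]
HB.structure Definition NormedVector (R : realType) :=
  {V of NormedModule R V & Vector R V}.

Record normed_space (R : realType) (m : nat) := NormedSpace {
  ns_carrier :> normedVectType R ;
  ns_dim : \dim {: ns_carrier} = m }.

Definition borelType (R : realType) (V : normedVectType R) :=
  g_sigma_algebraType (@open V).

(* On a finite-dimensional space a Borel measure that is finite on compact sets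
   is automatically regular, so regularity need not be required. *)
Definition haar_measure (R : realType) (V : normedVectType R)
    (nu : {measure set (borelType V) -> \bar R}) : Prop :=
  [/\ forall (v : V) (B : set (borelType V)), measurable B ->
        nu [set v + x | x in (B : set V)] = nu B,
      forall K : set V, compact K -> (nu K < +oo)%E &
      forall U : set V, open U -> U !=set0 -> (0 < nu U)%E].

Definition parallelepiped (R : realType) (V : normedVectType R) (n : nat)
    (p : V) (b : n.-tuple V) : set V :=
  [set p + \sum_(i < n) t i *: tnth b i |
     t in [set t : 'I_n -> R | forall i, 0 <= t i <= 1]].

Definition is_parallelepiped (R : realType) (m : nat) (V : normed_space R m)
    (P : set V) : Prop :=
  exists (p : V) (b : m.-tuple V),
    basis_of {: V} b /\ P = parallelepiped p b.

Definition opnorm (R : realType) (V W : normedVectType R)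
    (A : {linear V -> W}) : \bar R :=
  ereal_sup [set `|A x|%:E | x in closed_ball (0 : V) 1].

Definition norm_induced_by (R : realType) (V : normedVectType R)
    (f : {dot V for idfun}) : Prop :=
  forall x : V, `|x| = Num.sqrt (f x x).

(* The standard volume of a Euclidean space is its Haar measure giving mass 1 to
   the unit cube spanned by any orthonormal basis. *)
Definition euclidean_volume (R : realType) (m : nat) (V : normed_space R m)
    (f : {dot V for idfun}) (nu : {measure set (borelType V) -> \bar R}) :
    Prop :=
  haar_measure nu /\
  forall b : m.-tuple V,
    (forall i j, f (tnth b i) (tnth b j) = (i == j)%:R) ->
    nu (parallelepiped 0 b) = 1%E.

(* When A is not injective, A(B) need not be Borel even if B is, hence the outer
   measure [mu_ext] in [fv_contract]; it agrees with the measure on Borel sets. *)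
Record finsler_volume (R : realType) (m : nat) := FinslerVolume {
  fv_measure :> forall V : normed_space R m,
    {measure set (borelType V) -> \bar R} ;
  fv_haar : forall V, haar_measure (fv_measure V) ;
  fv_contract : forall (V W : normed_space R m) (A : {linear V -> W}),
    (opnorm A <= 1)%E ->
    forall B : set (borelType V), measurable B ->
      (mu_ext (fv_measure W) [set A x | x in (B : set V)]
         <= fv_measure V B)%E ;
  fv_euclidean : forall (V : normed_space R m) (f : {dot V for idfun}),
    norm_induced_by f -> euclidean_volume f (fv_measure V) }.

(* Haar measures are unique up to a positive factor, so minimality does not
   depend on the choice of [lam]. *)
Definition minimal_parallelepiped (R : realType) (m : nat)
    (V : normed_space R m) (lam : {measure set (borelType V) -> \bar R})
    (P : set V) : Prop :=
  [/\ is_parallelepiped P, closed_ball (0 : V) 1 `<=` P &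
      forall Q : set V, is_parallelepiped Q -> closed_ball (0 : V) 1 `<=` Q ->
        (lam P <= lam Q)%E].

Definition gromov_mass_star (R : realType) (m : nat)
    (mu : finsler_volume R m) : Prop :=
  forall (V : normed_space R m) (lam : {measure set (borelType V) -> \bar R})
    (P : set V),
    haar_measure lam -> minimal_parallelepiped lam P -> mu V P = (2 ^+ m)%:E.

Record rVnorm (R : realType) (m : nat) := RVNorm {
  rVnorm_fun :> 'rV[R]_m -> R ;
  rVnormD : forall x y, rVnorm_fun (x + y) <= rVnorm_fun x + rVnorm_fun y ;
  rVnormZ : forall (a : R) x, rVnorm_fun (a *: x) = `|a| * rVnorm_fun x ;
  rVnorm0_eq0 : forall x, rVnorm_fun x = 0 -> x = 0 }.

Definition normed_rV (R : realType) (m : nat) (N : rVnorm R m) : Type :=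
  'rV[R]_m.

Section normed_rV_instances.
Variables (R : realType) (m : nat) (N : rVnorm R m).
HB.instance Definition _ := Vector.copy (normed_rV N) 'rV[R]_m.
HB.instance Definition _ := @Lmodule_isNormed.Build R (normed_rV N)
  (rVnorm_fun N) (@rVnormD R m N) (@rVnormZ R m N) (@rVnorm0_eq0 R m N).
End normed_rV_instances.

Lemma dim_normed_rV (R : realType) (m : nat) (N : rVnorm R m) :
  \dim {: normed_rV N} = m.
Proof. by rewrite dimvf /dim/= mul1n. Qed.

Definition rV_space (R : realType) (m : nat) (N : rVnorm R m) :
    normed_space R m :=
  NormedSpace (dim_normed_rV N).

Definition eucl_norm (R : realType) (m : nat) (x : 'rV[R]_m) : R :=
  Num.sqrt (\sum_(i < m) x 0 i ^+ 2).

Section eucl_norm_is_norm.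
Variables (R : realType) (m : nat).
Implicit Types x y z : 'rV[R]_m.

Let sq x : R := \sum_(i < m) x 0 i ^+ 2.
Let dt x y : R := \sum_(i < m) x 0 i * y 0 i.

Let sq_ge0 x : 0 <= sq x.
Proof. by apply: sumr_ge0 => i _; exact: sqr_ge0. Qed.

Let sqD x y (a : R) : sq (x + a *: y) = sq x + (2 * a) * dt x y + a ^+ 2 * sq y.
Proof.
rewrite /sq /dt !mulr_sumr -!big_split/=; apply: eq_bigr => i _.
by rewrite !mxE; ring.
Qed.

Let sq_eq0 x : sq x = 0 -> x = 0.
Proof.
move=> /eqP; rewrite psumr_eq0 => [/allP x0|i _]; last exact: sqr_ge0.
apply/rowP => i; rewrite mxE; apply/eqP.
by have := x0 i (mem_index_enum i); rewrite /= sqrf_eq0.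
Qed.

Let cauchy_schwarz x y : dt x y ^+ 2 <= sq x * sq y.
Proof.
have [y0|y0] := eqVneq (sq y) 0.
  rewrite y0 mulr0 /dt big1 ?expr0n// => i _.
  by rewrite (sq_eq0 y0) mxE mulr0.
have yp : 0 < sq y by rewrite lt_neqAle eq_sym y0 sq_ge0.
have := sq_ge0 (x + (- (dt x y / sq y)) *: y); rewrite sqD.
have -> : sq x + 2 * - (dt x y / sq y) * dt x y + (- (dt x y / sq y)) ^+ 2 * sq y
  = (sq x * sq y - dt x y ^+ 2) / sq y by field.
by rewrite pmulr_lge0 ?invr_gt0// subr_ge0.
Qed.

Lemma eucl_normD x y : eucl_norm (x + y) <= eucl_norm x + eucl_norm y.
Proof.
have s0 z : 0 <= eucl_norm z := sqrtr_ge0 _.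
have nE z : eucl_norm z ^+ 2 = sq z by rewrite sqr_sqrtr// sq_ge0.
have le2 (a b : R) : 0 <= b -> a ^+ 2 <= b ^+ 2 -> a <= b.
  by move=> b0; apply: contraTT; rewrite -!ltNge => ab; nra.
have dt_le : dt x y <= eucl_norm x * eucl_norm y.
  apply: le2; first exact: mulr_ge0 (s0 x) (s0 y).
  by rewrite exprMn !nE.
apply: le2; first exact: addr_ge0 (s0 x) (s0 y).
by have := sqD x y 1; rewrite scale1r sqrrD !nE => ->; lra.
Qed.

Lemma eucl_normZ (a : R) x : eucl_norm (a *: x) = `|a| * eucl_norm x.
Proof.
rewrite /eucl_norm -sqrtr_sqr -sqrtrM ?sqr_ge0// mulr_sumr; congr Num.sqrt.
by apply: eq_bigr => i _; rewrite mxE exprMn.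
Qed.

Lemma eucl_norm0_eq0 x : eucl_norm x = 0 -> x = 0.
Proof.
move/eqP; rewrite sqrtr_eq0 => x0; apply: sq_eq0; apply/eqP.
by rewrite eq_le x0 sq_ge0.
Qed.

End eucl_norm_is_norm.

Definition euclidean (R : realType) (m : nat) : rVnorm R m :=
  RVNorm (@eucl_normD R m) (@eucl_normZ R m) (@eucl_norm0_eq0 R m).

(* All norms on R^m have the same Borel sets, so it does not matter which norm
   the measurability of [B] refers to. *)
Definition volume_le (R : realType) (m : nat) (mu : finsler_volume R m)
    (N N' : rVnorm R m) : Prop :=
  forall B : set 'rV[R]_m,
    measurable (B : set (borelType (rV_space N'))) ->
    (mu (rV_space N) B <= mu (rV_space N') B)%E.

Definition euclidean_rigid (R : realType) (m : nat)
    (mu : finsler_volume R m) : Prop :=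
  forall N : rVnorm R m,
    (forall x, euclidean R m x <= N x) ->
    volume_le mu N (euclidean R m) ->
    forall x, N x = euclidean R m x.

(* Main.v *)
(* Duality turns minimal parallelepipeds into maximal determinants: the slabs
   [|<f_i, x>| <= 1] contain the unit ball of [N] iff every [f_i] lies in the
   dual unit ball, and the volume they cut out is proportional to
   [1 / |det (f_i)|].  As [N >= |.|], the dual ball contains the Euclidean one,
   so the maximum of [|det|] over the dual ball is at least 1.  If [P] is
   minimal, then [2^m = mu_N P <= mu_{|.|} P = 2^m / max |det|], so this maximum
   is exactly 1.  If [N u > 1 = |u|] for some [u], strict convexity of the
   Euclidean ball puts the unit ball of [N] in a slab [|<u, x>| <= s] with
   [s < 1]; then [u / s] and an orthonormal basis of the complement of [u] lie
   in the dual ball and have determinant [1 / s > 1], a contradiction.  That a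
   Haar measure scales by [|det|] follows from the LUP decomposition: a
   unitriangular change of coordinates maps the unit cell to another fundamental
   domain of the same lattice, and a stretch along an axis is handled by Cauchy's
   functional equation. *)

Require Import Defs.
From HB Require Import structures.
From mathcomp Require Import all_boot all_order all_algebra.
From mathcomp Require Import all_classical all_reals all_analysis.
From mathcomp Require Import fingroup perm sesquilinear.
From mathcomp Require Import ring lra zify.

Set Implicit Arguments.
Unset Strict Implicit.
Unset Printing Implicit Defensive.

Import Order.TTheory GRing.Theory Num.Theory.
Import numFieldNormedType.Exports.

Local Open Scope classical_set_scope.
Local Open Scope ring_scope.

(** * Triangular changes of basis modulo a lattice *)

Section triangular_lattice.
(** The ranking [r] lets one argument serve both kinds of triangular matrix: [r = id] makes [T]
    upper triangular, [r = rev_ord] lower triangular. *)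
Variables (R : realType) (m : nat) (T : 'M[R]_m) (r : 'I_m -> 'I_m).
Hypothesis r_inj : injective r.
Hypothesis T_tri : forall i j, (r j < r i)%N -> T i j = 0.
Hypothesis T_diag : forall i, `|T i i| = 1.

Let T_diag_sqr i : T i i * T i i = 1.
Proof. by rewrite -expr2 -real_normK ?num_real// T_diag expr1n. Qed.

Let intT_diag i : {e : int | T i i = e%:~R}.
Proof.
have [/esym e|ne] := eqVneq 1 (T i i); first by exists 1.
exists (-1); rewrite rmorphN1; have /eqP := T_diag_sqr i.
rewrite -subr_eq0 -expr2 subr_sqr_1 mulf_eq0 subr_eq0 eq_sym (negbTE ne).
by rewrite addr_eq0 => /eqP.
Qed.

(** Coordinates are reduced in increasing rank: row [j0] of [T] vanishes at columns of smaller rank,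
    so changing [n] at [j0] leaves the coordinates already reduced untouched. *)
Lemma triangular_reduction (y : 'rV[R]_m) : exists n : 'rV[int]_m,
  forall j, 0 <= ((y + map_mx intr n) *m T) 0 j < 1.
Proof.
suff /(_ m)[n nP] : forall k, exists n : 'rV[int]_m,
    forall j, (r j < k)%N -> 0 <= ((y + map_mx intr n) *m T) 0 j < 1.
  by exists n => j; exact: nP.
elim=> [|k [n nP]]; first by exists 0.
have [[j0 rj0]|nj] := pselect (exists j, r j = k :> nat); last first.
  exists n => j; rewrite ltnS leq_eqVlt => /orP[/eqP rjk|]; last exact: nP.
  by case: nj; exists j.
have [e eE] := intT_diag j0.
set z := ((y + map_mx intr n) *m T) 0 j0.
(* The factor [e = T j0 j0] is a sign, so coordinate [j0] drops by [floor z * e * e = floor z]. *)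
exists (n - (Num.floor z * e) *: delta_mx 0 j0) => j.
have -> : ((y + map_mx intr (n - (Num.floor z * e) *: delta_mx 0 j0)) *m T) 0 j
    = ((y + map_mx intr n) *m T) 0 j - (Num.floor z)%:~R * T j0 j0 * T j0 j.
  rewrite map_mxB map_mxZ addrA mulmxBl -scalemxAl map_delta_mx -rowE rmorphM/=.
  by rewrite -eE [LHS]mxE; congr (_ + _); rewrite !mxE.
rewrite ltnS leq_eqVlt => /orP[/eqP rjk|rjk]; last first.
  by rewrite [T j0 j]T_tri ?rj0// mulr0 subr0; exact: nP.
have -> : j = j0 by apply: r_inj; apply: val_inj; rewrite /= rjk.
rewrite -mulrA T_diag_sqr mulr1 -/z subr_ge0 ltrBlDl.
by rewrite floor_le /= -[1]/(1%:~R) -rmorphD/= -floor_lt_int ltrDl.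
Qed.

(** Induction on rank: once [n] and [n'] agree in smaller ranks, the two [j]-th coordinates differ
    by plus or minus the integer [n 0 j - n' 0 j], while both lie in [0, 1). *)
Lemma triangular_reduction_uniq (y : 'rV[R]_m) (n n' : 'rV[int]_m) :
  (forall j, 0 <= ((y + map_mx intr n) *m T) 0 j < 1) ->
  (forall j, 0 <= ((y + map_mx intr n') *m T) 0 j < 1) -> n = n'.
Proof.
move=> nP n'P.
suff d0 k j : (r j < k)%N -> n 0 j = n' 0 j.
  by apply/rowP => j; apply: (d0 m).
elim: k => // k IH in j *; rewrite ltnS leq_eqVlt => /orP[/eqP rjk|]; last exact: IH.
have dE : ((y + map_mx intr n) *m T) 0 j - ((y + map_mx intr n') *m T) 0 j
    = (n 0 j - n' 0 j)%:~R * T j j.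
  transitivity ((map_mx intr (n - n') *m T) 0 j : R).
    by rewrite map_mxB mulmxBl 2!mulmxDl !mxE; ring.
  rewrite mxE (bigD1 j)//= big1 ?addr0 ?mxE// => i ij.
  rewrite !mxE.
  have [ri|] := ltnP (r i) (r j).
    by rewrite IH ?subrr ?mul0r// -rjk.
  rewrite leq_eqVlt => /orP[/eqP/val_inj/r_inj ji|/T_tri->]; last by rewrite mulr0.
  by rewrite ji eqxx in ij.
have : `|(n 0 j - n' 0 j)%:~R : R| < 1.
  have -> : `|(n 0 j - n' 0 j)%:~R : R| = `|(n 0 j - n' 0 j)%:~R * T j j|.
    by rewrite normrM T_diag mulr1.
  rewrite -dE.
  by move: (nP j) (n'P j) => /andP[? ?] /andP[? ?]; rewrite ltr_norml; lra.
rewrite -intr_norm -[1]/(1%:~R) ltr_int.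
by move=> h; lia.
Qed.

End triangular_lattice.

(** Cauchy's functional equation on the half-line: nonnegativity makes [g] monotone, and a monotone
    additive function is squeezed between its values at integers. *)
Lemma additive_ge0_linear (R : realType) (g : R -> \bar R) (c : R) :
  (forall s, (0 <= g s)%E) ->
  (forall s t, 0 <= s -> 0 <= t -> g (s + t) = (g s + g t)%E) ->
  g 1 = c%:E -> forall s, 0 <= s -> g s = (s * c)%:E.
Proof.
move=> g_ge0 gD g1.
have g_le s t : 0 <= s -> s <= t -> (g s <= g t)%E.
  by move=> s0 st; rewrite -(subrK s t) gD ?subr_ge0// leeDr.
have g0 : g 0 = 0%E.
  (* Finiteness of [g 1] allows its cancellation in [g 1 = g 0 + g 1]. *)
  have := gD 0 1 (lexx _) ler01; rewrite add0r g1.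
  have := g_ge0 0; case: (g 0) => //= r _ -[] /eqP.
  by rewrite eq_sym -subr_eq0 addrK => /eqP ->.
have gM n s : 0 <= s -> g (n%:R * s) = (n%:R%:E * g s)%E.
  move=> s0; elim: n => [|n IH]; first by rewrite mul0r mul0e.
  by rewrite -natr1 mulrDl mul1r gD ?mulr_ge0// IH EFinD ge0_muleDl ?lee_fin// mul1e.
move=> s s0.
have : g s \is a fin_num.
  have [n sn] : exists n : nat, s <= n%:R.
    by exists (Num.bound s); exact/ltW/archi_boundP.
  rewrite ge0_fin_numE//; apply: le_lt_trans (g_le _ _ s0 sn) _.
  by rewrite -[n%:R]mulr1 gM// g1 -EFinM ltry.
move/fineK => gs; rewrite -gs; congr EFin; set h := fine (g s).
have c0 : 0 <= c by rewrite -lee_fin -g1.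
(* With k <= n s < k + 1, both n h and n s c lie between k c and (k + 1) c; since n is arbitrary, h
   = s c. *)
have close (n : nat) : n%:R * `|h - s * c| <= c.
  have [k1 k2] : ((Num.trunc (n%:R * s))%:R <= n%:R * s) /\
      (n%:R * s < (Num.trunc (n%:R * s)).+1%:R).
    by have /andP[] := truncn_itv (mulr_ge0 (ler0n R n) s0).
  set k := Num.trunc _ in k1 k2.
  have gk j : g j%:R = (j%:R * c)%:E by rewrite -[j%:R]mulr1 gM// g1 mulr1 EFinM.
  have := g_le _ _ (ler0n R k) k1; have := g_le _ _ (mulr_ge0 (ler0n R n) s0) (ltW k2).
  rewrite !gk gM// -gs -/h -EFinM !lee_fin -natr1 => h1 h2.
  have := ler_wpM2r c0 k1; have := ler_wpM2r c0 (ltW k2); rewrite -natr1 => h3 h4.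
  rewrite -[n%:R]ger0_norm ?ler0n// -normrM ler_norml; nra.
apply/eqP; rewrite -subr_eq0 -normr_le0 leNgt; apply/negP => d0.
have := close (Num.bound (c / `|h - s * c|)); apply/negP; rewrite -ltNge.
rewrite -ltr_pdivrMr//; apply: archi_boundP.
by rewrite divr_ge0 // ltW.
Qed.

(** * Haar measure of parallelepipeds *)

(* [A] acts on row vectors, so the constraints are the columns of [A]. *)
Definition box (R : realType) (m : nat) (A : 'M[R]_m) (a b : 'I_m -> R) :
    set 'rV[R]_m :=
  [set x | forall i, a i <= (x *m A) 0 i < b i].

(** For invertible [A], the parallelepiped spanned by the rows of [invmx A]; it is half-open so that
    its lattice translates tile without overlap. *)
Definition cell (R : realType) (m : nat) (A : 'M[R]_m) : set 'rV[R]_m :=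
  box A (fun=> 0) (fun=> 1).

Lemma eucl_norm_coord (R : realType) (m : nat) (x : 'rV[R]_m) i :
  `|x 0 i| <= eucl_norm x.
Proof.
rewrite -sqrtr_sqr ler_wsqrtr// (bigD1 i)//= lerDl sumr_ge0// => j _.
exact: sqr_ge0.
Qed.

Lemma lup_decomposition (F : fieldType) (m : nat) (A : 'M[F]_m) :
  exists (s : 'S_m) (L U : 'M[F]_m), [/\ A = perm_mx s *m L *m U,
    forall i j : 'I_m, (i <= j)%N -> L i j = (i == j)%:R &
    forall i j : 'I_m, (j < i)%N -> U i j = 0].
Proof.
case: m A => [|m] A.
  by exists 1%g, A, A; split => [|[]//|[]//]; rewrite [RHS]thinmx0; exact: thinmx0.
have := cormen_lup_correct A; have := cormen_lup_perm A.
have := @cormen_lup_lower _ _ A; have := @cormen_lup_upper _ _ A.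
case: (cormen_lup A) => [[P L] U] /= U_up L_low /is_perm_mxP[s ->] E.
exists s^-1%g, L, U; split=> //.
by rewrite -mulmxA -[L *m U]E -mulmxE mulmxA -perm_mxM mulVg perm_mx1 mul1mx.
Qed.

Section box_measure.
Variables (R : realType) (m : nat) (N : rVnorm R m).
Hypothesis le_N : forall x, euclidean R m x <= N x.

Let measurableN (S : set 'rV[R]_m) :=
  measurable (S : set (borelType (rV_space N))).

Lemma open_halfspace (A : 'M[R]_m) i c :
  open ([set x | (x *m A) 0 i < c] : set (rV_space N)).
Proof.
rewrite openE => x /= xc; apply/nbhs_ballP.
(* A Lipschitz constant of the linear form for [N], since [N] dominates every coordinate; the
   summand 1 keeps it positive. *)
set C := 1 + \sum_j `|A j i|.
have C0 : 0 < C by rewrite ltr_pwDl// sumr_ge0.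
exists ((c - (x *m A) 0 i) / C) => /=; first by rewrite divr_gt0 ?subr_gt0.
move=> y; rewrite -ball_normE/= => xy.
have : `|((x - y) *m A) 0 i| <= C * N (x - y).
  rewrite mxE (le_trans (ler_norm_sum _ _ _))//.
  rewrite mulrDl mul1r mulr_suml ler_wpDl//.
    exact: le_trans (sqrtr_ge0 _) (le_N _).
  apply: ler_sum => j _; rewrite normrM mulrC ler_wpM2l//.
  exact: le_trans (eucl_norm_coord _ _) (le_N _).
rewrite ltr_pdivlMr// mulrC in xy.
move=> /le_lt_trans/(_ xy); rewrite mulmxBl !mxE distrC => /(le_lt_trans (ler_norm _)).
by rewrite ltrBlDr subrK.
Qed.

Lemma measurable_lt (A : 'M[R]_m) i c :
  measurableN [set x | (x *m A) 0 i < c].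
Proof. by apply: sub_sigma_algebra; exact: open_halfspace. Qed.

Lemma measurable_ge (A : 'M[R]_m) i c :
  measurableN [set x | c <= (x *m A) 0 i].
Proof.
have := measurableC (measurable_lt A i c).
by congr measurable; apply/seteqP; split => x /=; rewrite leNgt => /negP.
Qed.

Lemma measurable_box (A : 'M[R]_m) a b : measurableN (box A a b).
Proof.
have -> : box A a b = \bigcap_(i in [set: 'I_m])
    ([set x | a i <= (x *m A) 0 i] `&` [set x | (x *m A) 0 i < b i]).
  apply/seteqP; split => x /= xP i; first by move=> _; split; case/andP: (xP i).
  by have [? ?] := xP i I; apply/andP; split.
apply: fin_bigcap_measurable; first exact: finite_finset.
by move=> i _; apply: measurableI; [exact: measurable_ge|exact: measurable_lt].
Qed.

Lemma measurable_closed_box (A : 'M[R]_m) a b :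
  measurableN [set x | forall i, a i <= (x *m A) 0 i <= b i].
Proof.
have -> : [set x : 'rV[R]_m | forall i, a i <= (x *m A) 0 i <= b i] =
    \bigcap_(i in [set: 'I_m])
    ([set x | a i <= (x *m A) 0 i] `&` [set x | - b i <= (x *m (- A)) 0 i]).
  have NE (x : 'rV[R]_m) i : (x *m - A) 0 i = - (x *m A) 0 i.
    by rewrite mulmxN mxE.
  apply/seteqP; split => x /= xP i.
    by move=> _ /=; rewrite NE lerN2; case/andP: (xP i).
  by have := xP i I; rewrite /= NE lerN2 => -[? ?]; apply/andP; split.
apply: fin_bigcap_measurable; first exact: finite_finset.
by move=> i _; apply: measurableI; exact: measurable_ge.
Qed.

Variable nu : {measure set (borelType (rV_space N)) -> \bar R}.
Hypothesis nuD : forall (v : rV_space N) (B : set (borelType (rV_space N))),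
  measurable B -> nu [set v + x | x in (B : set (rV_space N))] = nu B.

Let shiftE (v : 'rV[R]_m) (S : set 'rV[R]_m) :
  [set v + x | x in S] = [set x | S (x - v)].
Proof.
apply/seteqP; split => [_ [x Sx <-]|x Sx] /=; first by rewrite addrC addKr.
by exists (x - v) => //; rewrite addrC subrK.
Qed.

Lemma measure_shift (v : 'rV[R]_m) (S : set 'rV[R]_m) : measurableN S ->
  nu [set x : 'rV[R]_m | S (x - v)] = nu S.
Proof. by move=> mS; rewrite -shiftE; exact: nuD. Qed.

Lemma box_shift (A : 'M[R]_m) a b (w : 'rV[R]_m) :
  [set x | box A a b (x - w)] =
  box A (fun i => a i + (w *m A) 0 i) (fun i => b i + (w *m A) 0 i).
Proof.
have BE (x : 'rV[R]_m) i : ((x - w) *m A) 0 i = (x *m A) 0 i - (w *m A) 0 i.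
  by rewrite mulmxBl !mxE.
by apply/seteqP; split => x /= xP i; have := xP i; rewrite BE lerBrDr ltrBlDr.
Qed.

(** Countable scissors congruence, used to compare two fundamental domains of one lattice. *)
Lemma measure_eq_cover (E E' : nat -> set 'rV[R]_m) (D D' : set 'rV[R]_m) :
  (forall k, measurableN (E k)) -> (forall k, measurableN (E' k)) ->
  trivIset setT E -> trivIset setT E' ->
  \bigcup_k E k = D -> \bigcup_k E' k = D' ->
  (forall k, nu (E k) = nu (E' k)) -> nu D = nu D'.
Proof.
move=> mE mE' tE tE' <- <- EE'.
rewrite (measure_bigcup nu setT E (fun k _ => mE k) tE).
rewrite (measure_bigcup nu setT E' (fun k _ => mE' k) tE').
by apply: eq_eseriesr => k _; exact: EE'.
Qed.

(* [cell X] and [cell (X *m T)] are both fundamental domains of the lattice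
   generated by the rows of [invmx X]. *)
Lemma measure_cell_triangular (X T : 'M[R]_m) (r : 'I_m -> 'I_m) :
  X \in unitmx -> injective r ->
  (forall i j, (r j < r i)%N -> T i j = 0) -> (forall i, `|T i i| = 1) ->
  nu (cell (X *m T)) = nu (cell X).
Proof.
move=> Xu r_inj T_tri T_diag.
pose w (n : 'rV[int]_m) : 'rV[R]_m := map_mx intr n *m invmx X.
have wX n : w n *m X = map_mx intr n by rewrite /w mulmxKV.
(* Countable additivity runs over [nat]: the piece of an integer vector sits at its pickle code, and
   all other indices carry the empty set. *)
pose indexed (F : 'rV[int]_m -> set 'rV[R]_m) (k : nat) :=
  if (pickle_inv k : option 'rV[int]_m) is Some n then F n else set0.
have indexed_triv F : (forall n n' x, F n x -> F n' x -> n = n') ->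
    trivIset setT (indexed F).
  move=> F_uniq k k' _ _ [x []]; rewrite /indexed.
  have := @pickle_invK 'rV[int]_m k; have := @pickle_invK 'rV[int]_m k'.
  by case: pickle_inv => //= n' <-; case: pickle_inv => //= n <- Fn /(F_uniq _ _ _ Fn) ->.
have indexed_cover F D : (forall n, F n `<=` D) -> (forall x, D x -> exists n, F n x) ->
    \bigcup_k indexed F k = D.
  move=> FD DF; apply/seteqP; split => x.
    by case=> k _; rewrite /indexed; case: pickle_inv => // n /FD.
  by move=> /DF[n Fnx]; exists (pickle n) => //; rewrite /indexed pickleK_inv.
(* The [F n] partition [cell X]; their translates [F' n] by [w n] partition [cell (X *m T)]. *)
pose F n := cell X `&` [set x : 'rV[R]_m | cell (X *m T) (x - - w n)].
pose F' n := [set x : 'rV[R]_m | F n (x - w n)].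
have F'E n : F' n = [set x | cell X (x - w n)] `&` cell (X *m T).
  by apply/seteqP; split => x; rewrite /F' /F /= opprK subrK => -[].
have cell_reduce (x : 'rV[R]_m) n : cell (X *m T) (x - - w n) <->
    forall j, 0 <= ((x *m X + map_mx intr n) *m T) 0 j < 1.
  by rewrite /cell /box /= -wX -mulmxDl -mulmxA opprK.
have cellX (x : 'rV[R]_m) n : cell X (x - w n) <->
    forall j, 0 <= ((x *m X + map_mx intr (- n)) *m 1%:M) 0 j < 1.
  by rewrite /cell /box /= mulmx1 mulmxBl wX map_mxN.
(* The identity is itself triangular, so the reduction lemmas also apply to [cell X]. *)
have one_tri (i j : 'I_m) : (j < i)%N -> (1%:M : 'M[R]_m) i j = 0.
  by move=> ji; rewrite mxE -val_eqE /= gtn_eqF.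
have one_diag i : `|(1%:M : 'M[R]_m) i i| = 1 by rewrite mxE eqxx normr1.
apply: (@measure_eq_cover (indexed F') (indexed F)).
- move=> k; rewrite /indexed; case: pickle_inv => [n|]; last exact: measurable0.
  by rewrite F'E box_shift; apply: measurableI; exact: measurable_box.
- move=> k; rewrite /indexed; case: pickle_inv => [n|]; last exact: measurable0.
  by rewrite /F box_shift; apply: measurableI; exact: measurable_box.
- apply: indexed_triv => n n' x; rewrite !F'E.
  move=> [/cellX xn _] [/cellX xn' _]; apply: oppr_inj.
  exact: triangular_reduction_uniq (@inj_id _) one_tri one_diag _ _ _ xn xn'.
- apply: indexed_triv => n n' x [_ /cell_reduce xn] [_ /cell_reduce xn'].
  exact: triangular_reduction_uniq r_inj T_tri T_diag _ _ _ xn xn'.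
- apply: indexed_cover => [n x|x Dx]; first by rewrite F'E => -[].
  have [n nP] := triangular_reduction (@inj_id _) one_tri one_diag (x *m X).
  by exists (- n); rewrite F'E; split => //; apply/cellX; rewrite opprK.
- apply: indexed_cover => [n x []//|x Dx].
  have [n nP] := triangular_reduction r_inj T_tri T_diag (x *m X).
  by exists n; split => //; apply/cell_reduce.
- move=> k; rewrite /indexed; case: pickle_inv => // n; rewrite /F' measure_shift//.
  by rewrite /F box_shift; apply: measurableI; exact: measurable_box.
Qed.
(** The measure is additive in the [i]-th side length: a box of side s + t is cut into one of side s
    and a translate of one of side t. Cauchy's equation then gives linearity. *)
Lemma measure_box_stretch (X : 'M[R]_m) (d : 'I_m -> R) i s c :
  X \in unitmx -> 0 <= s ->
  nu (box X (fun=> 0) (fun j => if j == i then 1 else d j)) = c%:E ->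
  nu (box X (fun=> 0) (fun j => if j == i then s else d j)) = (s * c)%:E.
Proof.
move=> Xu s0 nu1.
pose B t := box X (fun=> 0) (fun j => if j == i then t else d j).
apply: (@additive_ge0_linear R (fun t => nu (B t))) => // {nu1 s s0} s t s0 t0.
pose w : 'rV[R]_m := s *: row i (invmx X).
have wX j : (w *m X) 0 j = if j == i then s else 0.
  rewrite -scalemxAl -row_mul mulVmx// !mxE eq_sym.
  by case: eqVneq => _; rewrite ?mulr1 ?mulr0.
have -> : B (s + t) = B s `|` [set x : 'rV[R]_m | B t (x - w)].
  rewrite /B box_shift; apply/seteqP; split => x /=.
    move=> xP; have [xs|xs] := ltP ((x *m X) 0 i) s; [left|right] => j.
      by have := xP j; case: eqVneq => // ->; rewrite xs => /andP[->].
    have := xP j; rewrite wX; case: eqVneq => [->|_]; rewrite ?addr0 ?add0r//.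
    by rewrite xs (addrC t) => /andP[].
  case=> xP j; have := xP j; rewrite ?wX; case: eqVneq => [->|_];
    rewrite ?addr0 ?add0r// => /andP[x1 x2]; apply/andP; split; lra.
rewrite measureU; first by congr (_ + _)%E; apply: measure_shift; exact: measurable_box.
- exact: measurable_box.
- by rewrite box_shift; exact: measurable_box.
rewrite /B box_shift -subset0 => x /= [/(_ i) x1 /(_ i)].
move: x1; rewrite wX eqxx add0r => /andP[_ x1] /andP[/le_lt_trans/(_ x1)].
by rewrite ltxx.
Qed.

Lemma measure_box (X : 'M[R]_m) (d : 'I_m -> R) c :
  X \in unitmx -> (forall i, 0 <= d i) -> nu (cell X) = c%:E ->
  nu (box X (fun=> 0) d) = ((\prod_i d i) * c)%:E.
Proof.
move=> Xu d0 cX.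
(* The sides listed in [e] are already stretched; the others still have length 1. *)
suff H (e : seq 'I_m) : uniq e ->
    nu (box X (fun=> 0) (fun j => if j \in e then d j else 1)) =
    ((\prod_(j <- e) d j) * c)%:E.
  rewrite -(H _ (index_enum_uniq _)); congr (nu (box _ _ _)).
  by apply/funext => j; rewrite mem_index_enum.
elim: e => [_|a e IH /= /andP[ae /IH{}IH]]; first by rewrite big_nil mul1r.
rewrite big_cons -mulrA.
have -> : (fun j => if j \in a :: e then d j else 1) =
  (fun j => if j == a then d a else if j \in e then d j else 1).
  by apply/funext => j; rewrite inE; case: eqVneq => //= ->.
apply: measure_box_stretch => //; rewrite -IH; congr (nu (box _ _ _)).
by apply/funext => j; case: eqVneq => //= ->; rewrite (negbTE ae).
Qed.

Lemma cell_mul_diag (X : 'M[R]_m) (d : 'rV[R]_m) : (forall i, 0 < d 0 i) ->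
  cell (X *m diag_mx d) = box X (fun=> 0) (fun i => (d 0 i)^-1).
Proof.
move=> d0.
have E (x : 'rV[R]_m) i : (x *m (X *m diag_mx d)) 0 i = (x *m X) 0 i * d 0 i.
  by rewrite mulmxA mul_mx_diag mxE.
apply/seteqP; split => x xP i; have := xP i; rewrite E -[_^-1]mul1r.
  by rewrite ltr_pdivlMr// pmulr_lge0.
by rewrite ltr_pdivlMr// pmulr_lge0.
Qed.

Lemma cell_perm (s : 'S_m) : cell (perm_mx s) = cell (1%:M : 'M[R]_m).
Proof.
have E (x : 'rV[R]_m) i : (x *m perm_mx s) 0 (s i) = x 0 i.
  rewrite mxE (bigD1 i)//= big1 ?addr0 ?mxE ?eqxx ?mulr1// => j ji.
  by rewrite !mxE (inj_eq perm_inj) (negbTE ji) mulr0.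
apply/seteqP; split => x xP i.
  by rewrite mulmx1 -E; exact: xP.
by rewrite -(permKV s i) E; have := xP (s^-1%g i); rewrite mulmx1.
Qed.

(** [U] factors as a triangular matrix with diagonal entries of absolute value 1, which preserves
    the measure of cells, times the diagonal matrix of the [|U i i|], which only rescales the
    sides. *)
Lemma measure_cell_upper (X U : 'M[R]_m) c :
  X \in unitmx -> U \in unitmx -> (forall i j : 'I_m, (j < i)%N -> U i j = 0) ->
  nu (cell X) = c%:E -> nu (cell (X *m U)) = (c / `|\det U|)%:E.
Proof.
move=> Xu Uu U_tri cX.
have detU : \det U = \prod_i U i i.
  rewrite -det_tr det_trig; last by apply/is_trig_mxP => i j ij; rewrite mxE U_tri.
  by apply: eq_bigr => i _; rewrite mxE.
have U_diag i : 0 < `|U i i|.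
  rewrite normr_gt0; move: Uu; rewrite unitmxE detU unitfE.
  by move=> /prodf_neq0; exact.
pose d : 'rV[R]_m := \row_i `|U i i|.
pose d' : 'rV[R]_m := \row_i `|U i i|^-1.
have dd' : diag_mx d' *m diag_mx d = 1%:M.
  apply/matrixP => i j; rewrite mul_mx_diag !mxE.
  by case: eqVneq => [->|]; rewrite ?mulr0n ?mul0r// mulr1n mulVf// gt_eqF.
have d'u : U *m diag_mx d' \in unitmx.
  by rewrite unitmx_mul Uu; have /mulmx1_unit[] := dd'.
have -> : X *m U = X *m (U *m diag_mx d') *m diag_mx d by rewrite -!mulmxA dd' mulmx1.
have TE i j : (U *m diag_mx d') i j = U i j / `|U j j| by rewrite mul_mx_diag !mxE.
rewrite cell_mul_diag => [|i]; last by rewrite mxE.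
rewrite (@measure_box _ _ c).
- congr EFin; rewrite mulrC detU normr_prod -prodfV; congr (_ * _).
  by apply: eq_bigr => i _; rewrite mxE.
- by rewrite unitmx_mul Xu.
- by move=> i; rewrite mxE invr_ge0.
rewrite (measure_cell_triangular (r := id))//.
- by move=> i j ji; rewrite TE U_tri ?mul0r.
- by move=> i; rewrite TE normrM normfV normr_id divff// gt_eqF.
Qed.

(** In the LUP decomposition the permutation preserves the unit cube, the unitriangular [L]
    preserves the measure, and [U] contributes the determinant. *)
Lemma measure_cell (A : 'M[R]_m) c : A \in unitmx ->
  nu (cell (1%:M : 'M[R]_m)) = c%:E -> nu (cell A) = (c / `|\det A|)%:E.
Proof.
have [s [L [U [-> L_low U_up]]]] := lup_decomposition A => + c1.
rewrite !unitmx_mul -andbA => /and3P[Pu Lu Uu].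
have detL : \det L = 1.
  rewrite det_trig; last first.
    apply/is_trig_mxP => i j ij.
    by rewrite (L_low _ _ (ltnW ij)) -val_eqE /= ltn_eqF.
  by rewrite big1// => i _; rewrite L_low ?eqxx.
have -> : `|\det (perm_mx s *m L *m U)| = `|\det U|.
  by rewrite !det_mulmx detL mulr1 normrM det_perm normr_sign mul1r.
apply: measure_cell_upper => //; first by rewrite unitmx_mul Pu.
rewrite (measure_cell_triangular (r := @rev_ord m))//.
- by rewrite cell_perm.
- exact: rev_ord_inj.
- move=> i j /=; rewrite ltn_sub2lE ?ltnS// => ij.
  by rewrite (L_low _ _ (ltnW ij)) -val_eqE /= ltn_eqF.
- by move=> i; rewrite L_low// eqxx normr1.
Qed.

(** The closed cell lies between the half-open cell and half-open boxes of side 1 + e, whose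
    measures converge to that of the cell as e tends to 0. *)
Lemma measure_closed_cell (A : 'M[R]_m) c : A \in unitmx ->
  nu (cell (1%:M : 'M[R]_m)) = c%:E ->
  nu [set x : 'rV[R]_m | forall i, 0 <= (x *m A) 0 i <= 1] = (c / `|\det A|)%:E.
Proof.
move=> Au c1; have cA := measure_cell Au c1.
set D := [set x | _]; set v := c / _.
have mD : measurableN D := measurable_closed_box A (fun=> 0) (fun=> 1).
apply/eqP; rewrite eq_le; apply/andP; split; last first.
  rewrite -cA; apply: le_measure.
  - by apply: mem_set; exact: measurable_box.
  - by apply: mem_set; exact: mD.
  by move=> x xP i; have /andP[-> /ltW->] := xP i.
have v0 : 0 <= v by rewrite -lee_fin -cA.
have le_expand e : 0 < e -> (nu D <= ((1 + e) ^+ m * v)%:E)%E.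
  move=> e0; rewrite -[m in _ ^+ m]card_ord -prodr_const -(measure_box Au)//.
    apply: le_measure; [apply: mem_set; exact: mD|apply: mem_set; exact: measurable_box|].
    by move=> x xP i; have /andP[-> x1] := xP i; rewrite (le_lt_trans x1)// ltrDl.
  by move=> _; rewrite addr_ge0// ltW.
apply/lee_addgt0Pr => e e0; rewrite -EFinD.
(* A crude linear bound on [0, 1] suffices to choose the enlargement [t] explicitly. *)
have expr1D_le (t : R) n : 0 <= t -> t <= 1 -> (1 + t) ^+ n <= 1 + 3 ^+ n * t.
  move=> t0 t1; elim: n => [|n IH]; first by rewrite !expr0; lra.
  have : 1 <= 3 ^+ n :> R by rewrite exprn_ege1// ler1n.
  rewrite !exprS; move: (3 ^+ n) IH => p IH h.
  apply: le_trans (ler_wpM2l (addr_ge0 ler01 t0) IH) _.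
  have : t <= p * t by rewrite ler_peMl.
  have : p * t * t <= p * t by rewrite ler_piMr// mulr_ge0// (le_trans ler01).
  by rewrite mulrDl mul1r mulrDr mulr1; lra.
pose C : R := 3 ^+ m * (v + 1).
have C0 : 0 < C by rewrite mulr_gt0// ?exprn_gt0// ltr_wpDl.
pose t := Num.min 1 (e / C).
have t0 : 0 < t by rewrite lt_min ltr01 divr_gt0.
apply: le_trans (le_expand t t0) _; rewrite lee_fin.
have t1 : t <= 1 by rewrite ge_min lexx.
apply: le_trans (ler_wpM2r v0 (expr1D_le t m (ltW t0) t1)) _.
rewrite mulrDl mul1r lerD2l.
have : t * C <= e by rewrite -ler_pdivlMr// ge_min lexx orbT.
apply: le_trans; rewrite /C -mulrA mulrCA ler_wpM2l ?(ltW t0)//.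
by rewrite ler_wpM2l ?exprn_ge0// lerDl.
Qed.

End box_measure.

(** * Euclidean geometry *)

Section eucl.
Variables (R : realType) (m : nat).
Implicit Types x y u : 'rV[R]_m.

Lemma eucl_norm_sqr x : eucl_norm x ^+ 2 = (x *m x^T) 0 0.
Proof.
rewrite sqr_sqrtr ?sumr_ge0 => [|//|i _]; last exact: sqr_ge0.
by rewrite mxE; apply: eq_bigr => i _; rewrite mxE expr2.
Qed.

Lemma eucl_norm_orthogonal x (H : 'M[R]_m) : H *m H^T = 1%:M ->
  eucl_norm (x *m H) = eucl_norm x.
Proof.
move=> HH; apply/eqP; rewrite -(eqrXn2 (n := 2))// ?sqrtr_ge0//.
by rewrite !eucl_norm_sqr trmx_mul mulmxA -(mulmxA x) HH mulmx1.
Qed.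

Lemma rVnorm_le_eucl (N : rVnorm R m) :
  exists2 C, 0 < C & forall x, N x <= C * eucl_norm x.
Proof.
exists (1 + \sum_i `|N (delta_mx 0 i)|); first by rewrite ltr_pwDl// sumr_ge0.
move=> x; rewrite [in leLHS](row_sum_delta x) mulrDl mul1r ler_wpDl ?sqrtr_ge0//.
have sum_le (s : seq 'I_m) : N (\sum_(i <- s) x 0 i *: delta_mx 0 i) <=
    \sum_(i <- s) `|N (delta_mx 0 i)| * eucl_norm x.
  elim: s => [|i s IH].
    by rewrite !big_nil -[0](scale0r (0 : 'rV_m)) rVnormZ normr0 mul0r.
  rewrite !big_cons (le_trans (rVnormD _ _ _))// lerD// rVnormZ mulrC.
  apply: le_trans (ler_norm _) _; rewrite normrM normr_id.
  by rewrite ler_wpM2l// eucl_norm_coord.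
by rewrite mulr_suml.
Qed.

(* Uniform convexity of the Euclidean ball: a point of the [N]-ball nearly
   extremal in the direction [u] is Euclidean close, hence [N]-close, to [u]. *)
Lemma strip_lt1 (N : rVnorm R m) u : (forall x, eucl_norm x <= N x) ->
  eucl_norm u = 1 -> 1 < N u ->
  exists s, [/\ 0 < s, s < 1 & forall x, N x <= 1 -> `|(x *m u^T) 0 0| <= s].
Proof.
move=> le_N u1 Nu; have [C C0 NC] := rVnorm_le_eucl N.
(* If N x <= 1 then N (u - x) >= N u - 1, so |u - x| >= (N u - 1) / C; and |u - x|^2 <= 2 - 2 <x, u>
   because |u| = 1 and |x| <= 1. *)
pose e := ((N u - 1) / C) ^+ 2 / 2.
have e0 : 0 < e by rewrite divr_gt0// exprn_gt0// divr_gt0// subr_gt0.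
have half x : N x <= 1 -> (x *m u^T) 0 0 <= 1 - e.
  move=> x1; have : (N u - 1) / C <= eucl_norm (u - x).
    rewrite ler_pdivrMr// mulrC; apply: le_trans (NC _).
    by rewrite lerBlDr -[in leLHS](subrK x u) (le_trans (rVnormD _ _ _))// lerD2l.
  rewrite -(ler_pXn2r (n := 2))// ?nnegrE ?sqrtr_ge0//; last first.
    by rewrite divr_ge0 ?subr_ge0 ?ltW.
  have -> : eucl_norm (u - x) ^+ 2 =
      eucl_norm u ^+ 2 + eucl_norm x ^+ 2 - 2 * (x *m u^T) 0 0.
    rewrite !eucl_norm_sqr linearB/= mulmxBr !mulmxBl.
    have -> : u *m x^T = (x *m u^T)^T by rewrite trmx_mul trmxK.
    by rewrite !mxE; ring.
  rewrite u1 /e => h.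
  have : eucl_norm x ^+ 2 <= 1.
    by rewrite expr_le1 ?sqrtr_ge0//; exact: le_trans (le_N _) x1.
  by move: h; lra.
(* The maximum with 1/2 secures [0 < s], as [s] is later inverted. *)
exists (Num.max (1 / 2) (1 - e)); split.
- by rewrite lt_max; apply/orP; left; lra.
- by rewrite gt_max; apply/andP; split; lra.
- move=> x x1; rewrite le_max; apply/orP; right; rewrite ler_norml half// andbT lerNl.
  have := @half (- x); rewrite -scaleN1r rVnormZ normrN1 mul1r => /(_ x1).
  by rewrite -scalemxAl [leLHS]mxE mulN1r.
Qed.

Lemma orthogonal_col (u : 'rV[R]_m) (i0 : 'I_m) : eucl_norm u = 1 ->
  exists2 H : 'M[R]_m, H *m H^T = 1%:M & col i0 H = u^T.
Proof.
move=> u1; pose e : 'rV[R]_m := delta_mx 0 i0; pose w := u - e.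
have [w0|w0] := eqVneq w 0.
  exists 1%:M; rewrite ?trmx1 ?mulmx1//; move/subr0_eq: w0 => ->.
  by rewrite colE mul1mx trmx_delta.
(* Householder reflection exchanging [e] and [u] *)
pose q := (w *m w^T) 0 0.
have q0 : q != 0.
  rewrite /q -eucl_norm_sqr sqrf_eq0; apply: contraNneq w0.
  by move=> /eucl_norm0_eq0 ->.
have wwT : w *m w^T = q%:M by rewrite [LHS]mx11_scalar.
pose H : 'M[R]_m := 1%:M - (2 / q) *: (w^T *m w).
have HT : H^T = H by rewrite /H linearB/= linearZ/= trmx1 trmx_mul trmxK.
exists H.
  have WW : (w^T *m w) *m (w^T *m w) = q *: (w^T *m w).
    by rewrite mulmxA -(mulmxA w^T) wwT mul_mx_scalar scalemxAl.
  rewrite HT /H; move: (w^T *m w) WW => W WW.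
  rewrite mulmxBl mul1mx mulmxBr mulmx1 -scalemxAl -scalemxAr WW !scalerA.
  have -> : 2 / q * (2 / q) * q = 2 / q + 2 / q by field.
  by rewrite scalerDl; set V := (2 / q) *: W; rewrite opprB addrK subrK.
have ee : e *m e^T = 1%:M.
  by rewrite trmx_delta mul_delta_mx; apply/matrixP => i j; rewrite !ord1 !mxE.
have uu : u *m u^T = 1%:M.
  by rewrite [LHS]mx11_scalar -eucl_norm_sqr u1 expr1n.
have eu : e *m u^T = u *m e^T.
  by rewrite -[LHS]trmxK trmx_mul trmxK; apply/matrixP => i j; rewrite !ord1 mxE.
pose p := (u *m e^T) 0 0.
have up : u *m e^T = p%:M by rewrite [LHS]mx11_scalar.
have qE : q = 2 - 2 * p.
  rewrite /q /w linearB/= mulmxBr !mulmxBl uu ee eu up !mxE eqxx /=; ring.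
(* Since <w, e> = p - 1 = - q / 2, the reflection sends e to e + w = u. *)
have weE : (2 / q) *: (w *m e^T) = (-1)%:M.
  rewrite /w mulmxBl ee up -[p%:M - _]raddfB/= scale_scalar_mx.
  congr (_%:M); have -> : p = 1 - q / 2 by rewrite qE; field.
  by field.
rewrite colE -trmx_delta -/e /H mulmxBl mul1mx -scalemxAl -mulmxA scalemxAr weE.
by rewrite mul_mx_scalar scaleN1r opprK /w linearB/= addrC subrK.
Qed.

End eucl.

(** * Maximal determinants in the polar *)

(* The columns of [F], as linear forms, lie in the dual unit ball of [N]. *)
Definition polar_mx (R : realType) (m : nat) (N : rVnorm R m) : set 'M[R]_m :=
  [set F | forall x, N x <= 1 -> forall i, `|(x *m F) 0 i| <= 1].

Section polar.
Variables (R : realType) (m : nat) (N : rVnorm R m).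
Hypothesis le_N : forall x, euclidean R m x <= N x.

Let N_ge0 x : 0 <= N x.
Proof. exact: le_trans (sqrtr_ge0 _) (le_N x). Qed.

Lemma polar_mx_orthogonal (H : 'M[R]_m) : H *m H^T = 1%:M -> polar_mx N H.
Proof.
move=> HH x x1 i; apply: le_trans (eucl_norm_coord _ _) _.
by rewrite eucl_norm_orthogonal//; exact: le_trans (le_N x) x1.
Qed.

(** Testing the polar condition on the normalized basis vector bounds the polar, which compactness
    requires. *)
Lemma polar_mx_entry F i j : polar_mx N F -> `|F i j| <= N (delta_mx 0 i).
Proof.
move=> NF; have [N0|N0] := eqVneq (N (delta_mx 0 i)) 0.
  have /rowP/(_ i) := rVnorm0_eq0 N0.
  by rewrite !mxE !eqxx => /eqP; rewrite oner_eq0.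
have Np : 0 < N (delta_mx 0 i) by rewrite lt_neqAle eq_sym N0 N_ge0.
have := NF ((N (delta_mx 0 i))^-1 *: delta_mx 0 i).
rewrite rVnormZ gtr0_norm ?invr_gt0// mulVf// => /(_ (lexx _) j).
rewrite -scalemxAl -rowE !mxE normrM gtr0_norm ?invr_gt0//.
by rewrite mulrC ler_pdivrMr// mul1r.
Qed.

Lemma compact_polar : compact [set v : 'rV[R]_(m * m) | polar_mx N (vec_mx v)].
Proof.
pose B (k : 'I_(m * m)) :=
  N (delta_mx 0 (enum_val (cast_ord (esym (mxvec_cast m m)) k)).1).
have KB : compact [set v : 'rV[R]_(m * m) | forall k, [set` `[- B k, B k]] (v 0 k)].
  apply: (@rV_compact R _ (fun k => [set` `[- B k, B k]])) => k.
  exact: segment_compact.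
apply: subclosed_compact KB _; last first.
  move=> v vP k /=; rewrite in_itv/= -ler_norml.
  case/mxvec_indexP: k => i j.
  have -> : v 0 (mxvec_index i j) = vec_mx v i j by rewrite mxE.
  apply: le_trans (polar_mx_entry i j vP) _.
  by rewrite /B /mxvec_index cast_ordK enum_rankK.
(* Closedness: the polar is an intersection of closed slabs, one for each point of the unit ball and
   each column. *)
have -> : [set v : 'rV[R]_(m * m) | polar_mx N (vec_mx v)] =
    \bigcap_(x in [set x | N x <= 1]) \bigcap_i
      ((fun v : 'rV[R]_(m * m) => (x *m vec_mx v) 0 i) @^-1` [set` `[-1, 1]]).
  apply/seteqP; split => v /=.
    by move=> vP x x1 i _ /=; rewrite in_itv/= -ler_norml; exact: vP.
  by move=> vP x x1 i; have := vP x x1 i I; rewrite /= in_itv/= -ler_norml.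
apply: closed_bigI => x _; apply: closed_bigI => i _.
suff cont : continuous (fun v : 'rV[R]_(m * m) => (x *m vec_mx v) 0 i).
  by apply: preimage_closed; [move=> v _; exact: cont|exact: itv_closed].
have -> : (fun v : 'rV[R]_(m * m) => (x *m vec_mx v) 0 i) =
    (fun v => \sum_j x 0 j * v 0 (mxvec_index j i)).
  by apply/funext => w; rewrite mxE; apply: eq_bigr => j _; rewrite mxE.
apply: continuous_big => [|j _]; first exact: add_continuous.
by move=> w; apply: continuousM; [exact: cst_continuous|exact: coord_continuous].
Qed.

Lemma continuous_det_vec : continuous (fun v : 'rV[R]_(m * m) => \det (vec_mx v)).
Proof.
apply: continuous_big => [|s _]; first exact: add_continuous.
move=> v; apply: (@continuousM R _ (fun=> (-1) ^+ s)
  (fun v : 'rV[R]_(m * m) => \prod_i (vec_mx v : 'M[R]_m) i (s i))).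
  exact: cst_continuous.
move: v.
apply: continuous_big => [|i _]; first exact: mul_continuous.
have -> : (fun v : 'rV[R]_(m * m) => vec_mx v i (s i)) =
    (fun v => v 0 (mxvec_index i (s i))).
  by apply/funext => w; rewrite mxE.
exact: coord_continuous.
Qed.

Lemma polar_mx_max_det : exists F, [/\ polar_mx N F, 1 <= `|\det F| &
  forall G, polar_mx N G -> `|\det G| <= `|\det F|].
Proof.
have P1 : polar_mx N 1%:M by apply: polar_mx_orthogonal; rewrite trmx1 mulmx1.
have [|||v vP vmax] := @EVT_max_rV R _ (fun v => `|\det (vec_mx v : 'M[R]_m)|)
    [set v | polar_mx N (vec_mx v)].
- by exists (mxvec 1%:M) => /=; rewrite mxvecK.
- exact: compact_polar.
- apply: continuous_subspaceT => v.
  apply: (@continuous_comp _ _ _ (fun v => \det (vec_mx v : 'M[R]_m)) Num.norm).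
    exact: continuous_det_vec.
  exact: norm_continuous.
have max G : polar_mx N G -> `|\det G| <= `|\det (vec_mx v : 'M[R]_m)|.
  by move=> GP; rewrite -[G]mxvecK; apply: vmax; apply: mem_set; rewrite /= mxvecK.
exists (vec_mx v); split => //; first exact: set_mem vP.
by have := max _ P1; rewrite det1 normr1.
Qed.

(** In an orthogonal matrix having [u] as a column, the strip estimate leaves room to divide that
    column by s < 1. *)
Lemma polar_mx_det_gt1 (u : 'rV[R]_m) : eucl_norm u = 1 -> 1 < N u ->
  exists2 G, polar_mx N G & 1 < `|\det G|.
Proof.
move=> u1 Nu; have [s [s0 s1 strip]] := strip_lt1 le_N u1 Nu.
(* A column index exists because dimension 0 has no unit vector. *)
have [i0 _] : exists i0 : 'I_m, true.
  case: (m) u u1 {Nu strip} => [|n] u u1; last by exists ord0.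
  have /eqP : (1 : R) = 0.
    by rewrite -u1 /eucl_norm big_ord0 sqrtr0.
  by rewrite oner_eq0.
have [H HH Hu] := orthogonal_col i0 u1.
pose d : 'rV[R]_m := \row_i (if i == i0 then s^-1 else 1).
exists (H *m diag_mx d).
  move=> x x1 i.
  have -> : (x *m (H *m diag_mx d)) 0 i = (x *m H) 0 i * d 0 i.
    by rewrite mulmxA mul_mx_diag mxE.
  rewrite [d 0 i]mxE; case: eqVneq => [->|_]; last first.
    by rewrite mulr1; exact: (polar_mx_orthogonal HH).
  have -> : (x *m H) 0 i0 = (x *m u^T) 0 0.
    by rewrite -Hu !mxE; apply: eq_bigr => j _; rewrite mxE.
  by rewrite normrM normfV (gtr0_norm s0) ler_pdivrMr// mul1r; exact: strip.
have detH : `|\det H| = 1.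
  apply/eqP; rewrite -sqrp_eq1// real_normK ?num_real// expr2 -[X in _ * X]det_tr.
  by rewrite -det_mulmx HH det1.
rewrite det_mulmx normrM detH mul1r det_diag (bigD1 i0)//= mxE eqxx.
rewrite big1 => [|i /negbTE ii0]; last by rewrite mxE ii0.
by rewrite mulr1 normfV (gtr0_norm s0) invf_gt1.
Qed.

End polar.

(** * Parallelepipeds *)

Definition rows_mx (R : realType) (m : nat) (b : m.-tuple 'rV[R]_m) : 'M[R]_m :=
  \matrix_(i < m) tnth b i.

Lemma mul_rows_mx (R : realType) (m : nat) (b : m.-tuple 'rV[R]_m) (t : 'rV[R]_m) :
  t *m rows_mx b = \sum_(i < m) t 0 i *: tnth b i.
Proof. by rewrite mulmx_sum_row; apply: eq_bigr => i _; rewrite rowK. Qed.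

Section parallelepipeds.
Variables (R : realType) (m : nat) (N : rVnorm R m).
Let V := rV_space N.
Let rows (b : m.-tuple V) : 'M[R]_m := rows_mx (b : m.-tuple 'rV[R]_m).

Lemma basis_rows_mx (b : m.-tuple V) :
  basis_of {: V} b = (rows b \in unitmx).
Proof.
rewrite basisEfree dim_normed_rV size_tuple leqnn andbT.
have -> : (<<b>> <= fullv)%VS by exact: subvf.
rewrite -row_free_unit; apply/idP/idP => [/andP[/freeP b_free _]|Bu].
  apply: inj_row_free => t tB; apply/rowP => i; rewrite mxE.
  apply: (b_free (fun i => t 0 i)); rewrite -[RHS]tB mul_rows_mx.
  by apply: eq_bigr => j _; rewrite (tnth_nth 0).
rewrite andbT; apply/freeP => k bk i.
have /(row_free_inj Bu)/rowP/(_ i) : (\row_i k i) *m rows b = 0 *m rows b.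
  by rewrite mul0mx mul_rows_mx -[RHS]bk; apply: eq_bigr => j _; rewrite mxE (tnth_nth 0).
by rewrite !mxE.
Qed.

(** Coordinates in the basis [b] turn a parallelepiped into a translated closed cell, whose measure
    is known. *)
Lemma parallelepipedE (p : V) (b : m.-tuple V) :
  rows b \in unitmx -> parallelepiped p b =
  [set x : 'rV[R]_m | forall i, 0 <= ((x - p) *m invmx (rows b)) 0 i <= 1].
Proof.
move=> Bu; apply/seteqP; split => x /=.
  case=> t t01 <- i; pose t' : 'rV[R]_m := \row_i t i.
  have -> : (p : 'rV[R]_m) + \sum_(i < m) t i *: tnth b i - p = t' *m rows b.
    by rewrite addrC addKr mul_rows_mx; apply: eq_bigr => j _; rewrite mxE.
  by rewrite mulmxK// mxE.
move=> xP; exists (fun i => ((x - p) *m invmx (rows b)) 0 i) => //.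
by rewrite -mul_rows_mx mulmxKV// addrC subrK.
Qed.

Lemma closed_unit_ballE :
  closed_ball (0 : V) 1 = [set x : 'rV[R]_m | N x <= 1].
Proof.
rewrite closed_ballE//; apply/seteqP; split => x;
  by rewrite /closed_ball_/= sub0r normrN.
Qed.

End parallelepipeds.

(** * The standard inner product and the normalization of the Euclidean volume *)

Definition eucl_dot (R : realType) (m : nat) (x y : rV_space (euclidean R m)) : R :=
  ((x : 'rV[R]_m) *m (y : 'rV[R]_m)^T) 0 0.

Section eucl_dot_form.
Variables (R : realType) (m : nat).
Let V := rV_space (euclidean R m).

Let eucl_dotC (x y : V) : eucl_dot x y = eucl_dot y x.
Proof. by rewrite /eucl_dot !mxE; apply: eq_bigr => i _; rewrite !mxE mulrC. Qed.

Let eucl_dot_linear (y : V) : GRing.linear_for *%R (fun x : V => eucl_dot x y).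
Proof. by move=> a u v; rewrite /eucl_dot mulmxDl -scalemxAl !mxE. Qed.

Let eucl_dot_bilinear : bilinear_for *%R (idfun \; *%R) (@eucl_dot R m).
Proof.
split=> [y|x]; first exact: eucl_dot_linear.
by move=> a u v /=; rewrite !(eucl_dotC x) eucl_dot_linear.
Qed.

HB.instance Definition _ := @bilinear_isBilinear.Build R V V R *%R (idfun \; *%R)
  (@eucl_dot R m) eucl_dot_bilinear.

Let eucl_dot_hermitian (x y : V) : eucl_dot x y = (-1) ^+ false * idfun (eucl_dot y x).
Proof. by rewrite mul1r eucl_dotC. Qed.

HB.instance Definition _ := @isHermitianSesquilinear.Build R V false idfun
  (@eucl_dot R m) eucl_dot_hermitian.

Let eucl_dot_gt0 (x : V) : x != 0 -> 0 < eucl_dot x x.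
Proof.
move=> x0; rewrite /eucl_dot -eucl_norm_sqr exprn_gt0// lt_neqAle sqrtr_ge0 andbT.
by rewrite eq_sym; apply: contraNneq x0 => /eucl_norm0_eq0 ->.
Qed.

HB.instance Definition _ := @isDotProduct.Build R V (@eucl_dot R m) eucl_dot_gt0.

End eucl_dot_form.

Definition eucl_dot_product (R : realType) (m : nat) :
  {dot rV_space (euclidean R m) for idfun} := @eucl_dot R m.

Lemma euclidean_unit_cube (R : realType) (m : nat) (mu : finsler_volume R m) :
  mu (rV_space (euclidean R m))
    [set x : 'rV[R]_m | forall i, 0 <= x 0 i <= 1] = 1%E.
Proof.
set V := rV_space _.
pose b : m.-tuple V := [tuple (row i 1%:M : 'rV[R]_m) | i < m].
have bE : rows_mx (b : m.-tuple 'rV[R]_m) = 1%:M.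
  by apply/row_matrixP => i; rewrite rowK tnth_mktuple.
have norm_dot : norm_induced_by (@eucl_dot_product R m).
  move=> x; rewrite /= /eucl_dot -eucl_norm_sqr sqrtr_sqr ger0_norm// sqrtr_ge0//.
have [_ /(_ b)] := fv_euclidean mu norm_dot.
rewrite parallelepipedE bE ?unitmx1// => <-; last first.
  move=> i j; rewrite !tnth_mktuple /= /eucl_dot !row1 trmx_delta.
  by rewrite mul_delta_mx_cond; case: (i == j); rewrite !mxE.
by congr (mu V _); apply/seteqP; split => x xP i; have := xP i;
  rewrite subr0 invmx1 mulmx1.
Qed.

(** * Volumes of circumscribed parallelepipeds and rigidity *)

Lemma measure_parallelepiped (R : realType) (m : nat) (N : rVnorm R m)
    (le_N : forall x, euclidean R m x <= N x)
    (nu : {measure set (borelType (rV_space N)) -> \bar R}) (c : R)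
    (p : rV_space N) (b : m.-tuple (rV_space N)) :
  haar_measure nu -> nu (cell (1%:M : 'M[R]_m)) = c%:E ->
  rows_mx (b : m.-tuple 'rV[R]_m) \in unitmx ->
  nu (parallelepiped p b) = (c * `|\det (rows_mx (b : m.-tuple 'rV[R]_m))|)%:E.
Proof.
case=> nuD _ _ c1 Bu; rewrite parallelepipedE//; set B := rows_mx _ in Bu *.
rewrite (@measure_shift _ _ _ nu nuD p
  [set x : 'rV[R]_m | forall i, 0 <= (x *m invmx B) 0 i <= 1]); last first.
  exact: (measurable_closed_box le_N _ (fun=> 0) (fun=> 1)).
rewrite (measure_closed_cell le_N nuD _ c1) ?unitmx_inv//.
by rewrite det_inv normfV invrK.
Qed.

(** The half-open cube lies in the closed one, which has Euclidean volume 1; the bound also makes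
    its [N]-volume finite. *)
Lemma measure_cell1_le1 (R : realType) (m : nat) (mu : finsler_volume R m)
    (N : rVnorm R m) : volume_le mu N (euclidean R m) ->
  exists2 c, c <= 1 & mu (rV_space N) (cell (1%:M : 'M[R]_m)) = c%:E.
Proof.
move=> vol.
have mcell : measurable
    (cell (1%:M : 'M[R]_m) : set (borelType (rV_space (euclidean R m)))).
  exact: measurable_box.
have le1 : (mu (rV_space N) (cell (1%:M : 'M[R]_m)) <= 1)%E.
  apply: le_trans (vol _ mcell) _; rewrite -(euclidean_unit_cube mu).
  apply: le_measure; [exact: mem_set|apply: mem_set|].
    have := @measurable_closed_box R m (euclidean R m) (fun=> lexx _) 1%:M
      (fun=> 0) (fun=> 1).
    by congr measurable; apply/seteqP; split => x xP i; have := xP i; rewrite mulmx1.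
  by move=> x xP i; have := xP i; rewrite mulmx1 => /andP[-> /ltW].
exists (fine (mu (rV_space N) (cell (1%:M : 'M[R]_m)))).
  by rewrite -lee_fin fineK// ge0_fin_numE// (le_lt_trans le1)// ltry.
by rewrite fineK// ge0_fin_numE// (le_lt_trans le1)// ltry.
Qed.

(* The witness is [{x | forall i, |(x F)_i| <= 1}]. *)
Lemma minimal_parallelepiped_polar (R : realType) (m : nat) (N : rVnorm R m)
    (le_N : forall x, euclidean R m x <= N x)
    (nu : {measure set (borelType (rV_space N)) -> \bar R}) (c : R) (F : 'M[R]_m) :
  haar_measure nu -> nu (cell (1%:M : 'M[R]_m)) = c%:E ->
  polar_mx N F -> F \in unitmx ->
  (forall G, polar_mx N G -> `|\det G| <= `|\det F|) ->
  exists2 P : set (rV_space N), minimal_parallelepiped nu P &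
    nu P = (c * (2 ^+ m / `|\det F|))%:E.
Proof.
move=> nu_haar c1 FP Fu Fmax; set V := rV_space N.
pose b : m.-tuple V := [tuple (row i (2 *: invmx F) : 'rV[R]_m) | i < m].
have bE : rows_mx (b : m.-tuple 'rV[R]_m) = 2 *: invmx F.
  by apply/row_matrixP => i; rewrite rowK tnth_mktuple.
have u2 : (2 : R) \is a GRing.unit by rewrite unitfE pnatr_eq0.
have bu : rows_mx (b : m.-tuple 'rV[R]_m) \in unitmx.
  by rewrite bE unitmxZ// unitmx_inv.
have det2 (G : 'M[R]_m) : `|\det (2 *: G)| = 2 ^+ m * `|\det G|.
  by rewrite detZ normrM ger0_norm// exprn_ge0.
(* With this corner and these edges, the coordinates of x are (x F + 1) / 2, which lie in [0, 1]
   exactly when the entries of x F lie in [-1, 1]. *)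
pose p : V := - const_mx 1 *m invmx F.
have nuP : nu (parallelepiped p b) = (c * (2 ^+ m / `|\det F|))%:E.
  by rewrite (measure_parallelepiped le_N p nu_haar c1 bu) bE det2 det_inv normfV.
exists (parallelepiped p b) => //; split.
- by exists p, b; rewrite basis_rows_mx.
- rewrite closed_unit_ballE parallelepipedE// => x x1 i.
  rewrite bE invmxZ -?bE// invmxK -scalemxAr mxE.
  have -> : ((x - p) *m F) 0 i = (x *m F) 0 i + 1.
    by rewrite /p mulNmx opprK mulmxDl mulmxKV// mxE [in X in _ + X]mxE.
  have := FP x x1 i; rewrite ler_norml => /andP[? ?]; apply/andP; split; lra.
- move=> Q [q [b' [+ ->]]]; rewrite basis_rows_mx => b'u ball_sub.
  rewrite nuP (measure_parallelepiped le_N q nu_haar c1 b'u) lee_fin.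
  set B := rows_mx _ in b'u *.
  have c0 : 0 <= c by rewrite -lee_fin -c1.
  apply: ler_wpM2l => //.
  (* Both x and -x lie in Q; subtracting their coordinates, each in [0, 1], eliminates the corner
     [q] and leaves twice the coordinate of x in [-1, 1]. *)
  have GP : polar_mx N (2 *: invmx B).
    move=> x x1 i; move: ball_sub; rewrite closed_unit_ballE parallelepipedE// => sub.
    have nx1 : N (- x) <= 1 by rewrite -scaleN1r rVnormZ normrN1 mul1r.
    have coordB (y : 'rV[R]_m) : ((y - q) *m invmx B) 0 i =
        (y *m invmx B) 0 i - ((q : 'rV[R]_m) *m invmx B) 0 i.
      by rewrite mulmxBl !mxE.
    have coordN : (- x *m invmx B) 0 i = - (x *m invmx B) 0 i.
      by rewrite mulNmx mxE.
    have := sub _ x1 i; have := sub _ nx1 i; rewrite !coordB coordN.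
    rewrite -scalemxAr [X in `|X|]mxE ler_norml => /andP[? ?] /andP[? ?].
    by apply/andP; split; lra.
  have := Fmax _ GP; rewrite det2 det_inv normfV.
  have B0 : 0 < `|\det B| by rewrite normr_gt0 -unitfE -unitmxE.
  have F0 : 0 < `|\det F| by rewrite normr_gt0 -unitfE -unitmxE.
  by rewrite !ler_pdivrMr// mulrC.
Qed.

Theorem lemma2p6 (R : realType) (m : nat) (hm : (1 <= m)%N)
    (mu : finsler_volume R m) (hmu : gromov_mass_star mu) :
  euclidean_rigid mu.
Proof.
move=> N le_N vol x.
have [c c_le1 c1] := measure_cell1_le1 vol.
have [F [FP F1 Fmax]] := polar_mx_max_det le_N.
have F0 : 0 < `|\det F| by exact: lt_le_trans F1.
have Fu : F \in unitmx by rewrite unitmxE unitfE -normr_gt0.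
have [P Pmin] := minimal_parallelepiped_polar le_N (fv_haar mu _) c1 FP Fu Fmax.
(* Both values of the volume of P give 2^m = c 2^m / |det F|, so |det F| = c <= 1. *)
rewrite (hmu _ _ _ (fv_haar mu _) Pmin) => -[] /eqP.
have p2 : 0 < 2 ^+ m :> R by rewrite exprn_gt0.
rewrite mulrA (mulrC c) -mulrA -[X in X == _]mulr1 (inj_eq (mulfI (lt0r_neq0 p2))).
move=> /eqP cF; have F_le1 : `|\det F| <= 1.
  by move: c_le1; rewrite -[in leLHS](divfK (lt0r_neq0 F0) c) -cF mul1r.
apply/eqP; rewrite eq_le le_N andbT leNgt; apply/negP => xN.
have x0 : 0 < eucl_norm x.
  rewrite lt_neqAle sqrtr_ge0 andbT eq_sym; apply: contraTneq xN => /eucl_norm0_eq0 ->.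
  by rewrite -[0](scale0r (0 : 'rV_m)) !rVnormZ normr0 !mul0r ltxx.
(* The normalized x would yield a polar matrix of determinant above 1, against the maximality of
   F. *)
have [||G GP] := @polar_mx_det_gt1 _ _ _ le_N ((eucl_norm x)^-1 *: x).
- by rewrite eucl_normZ gtr0_norm ?invr_gt0// mulVf// lt0r_neq0.
- by rewrite rVnormZ gtr0_norm ?invr_gt0// mulrC ltr_pdivlMr// mul1r.
by move=> /lt_le_trans/(_ (Fmax _ GP))/lt_le_trans/(_ F_le1); rewrite ltxx.
Qed.
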